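(* There is an absolute constant $C>0$ (independent of $d,\mathbf{B},f,L,m,\mathbf{x}_0,\varepsilon,k$) such that the following holds. Let $m\ge1$ be an integer, $M:=6mL$, $\varepsilon>0$, and let $\mathbf{x}_0,\mathbf{x}_1,\mathbf{x}_2,\dots$ be generated by the Cubic Newton method with Lazy Hessians (with parameters $m$ and $M$). Assume that the gradients for the previous iterations $\{\mathbf{x}_i\}_{i=1}^k$ satisfy $\|\nabla f(\mathbf{x}_i)\|_*\ge\varepsilon$ for all $1\le i\le k$. Then the number $k$ of iterations to reach accuracy $\|\nabla f(\mathbf{x}_{k+1})\|_*\le\varepsilon$ is at most $$k\;\le\;C\,\frac{\sqrt{mL}\,(f(\mathbf{x}_0)-f^\star)}{\varepsilon^{3/2}},$$ the total number $t$ of Hessian updates during these iterations satisfies $$t\;\le\;C\,\frac{\sqrt{L}\,(f(\mathbf{x}_0)-f^\star)}{\varepsilon^{3/2}\sqrt{m}},$$ and for the minimal eigenvalues of all Hessians it holds that $$\min_{1\le i\le k}\xi(\mathbf{x}_i)\;\le\;C\Bigl(\frac{M^2(f(\mathbf{x}_0)-f^\star)}{k}\Bigr)^{1/3}.$$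
   Context: $\mathbf{B}\in\mathbb{R}^{d\times d}$ is a fixed symmetric positive definite matrix, $\|\mathbf{x}\|=\langle \mathbf{B}\mathbf{x},\mathbf{x}\rangle^{1/2}$, $\|\mathbf{g}\|_*=\langle \mathbf{g},\mathbf{B}^{-1}\mathbf{g}\rangle^{1/2}$ for gradients, and $\|\mathbf{A}\|=\sup_{\|\mathbf{x}\|\le1}\|\mathbf{A}\mathbf{x}\|_*$ for matrices. The function $f:\mathbb{R}^d\to\mathbb{R}$ (not necessarily convex) is twice continuously differentiable, bounded below with $\inf f\ge f^\star\in\mathbb{R}$, and $\|\nabla^2 f(\mathbf{x})-\nabla^2 f(\mathbf{y})\|\le L\|\mathbf{x}-\mathbf{y}\|$ for all $\mathbf{x},\mathbf{y}\in\mathbb{R}^d$, with $L>0$. For $M>0$, $\mathbf{T}_M(\mathbf{x},\mathbf{z})$ denotes a global minimizer over $\mathbf{y}\in\mathbb{R}^d$ of $\langle\nabla f(\mathbf{x}),\mathbf{y}-\mathbf{x}\rangle+\frac12\langle\nabla^2 f(\mathbf{z})(\mathbf{y}-\mathbf{x}),\mathbf{y}-\mathbf{x}\rangle+\frac M6\|\mathbf{y}-\mathbf{x}\|^3$. Cubic Newton with Lazy Hessians: given $\mathbf{x}_0\in\mathbb{R}^d$, for $k=0,1,\dots$ set the last snapshot point $\mathbf{z}_k=\mathbf{x}_{\pi(k)}$ and compute $\mathbf{x}_{k+1}=\mathbf{T}_M(\mathbf{x}_k,\mathbf{z}_k)$, where $\pi(k)=k-(k\bmod m)$ is the largest multiple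 of $m$ not exceeding $k$. A Hessian update is a computation of the Hessian $\nabla^2 f$ at a new snapshot point; it is made once per $m$ iterations, at the iterations whose index $k$ is a multiple of $m$, and the Hessian is reused in between. $\xi(\mathbf{y})=\bigl[-\lambda_{\min}(\mathbf{B}^{-1/2}\nabla^2 f(\mathbf{y})\mathbf{B}^{-1/2})\bigr]_+$, where $[s]_+=\max\{s,0\}$ and $\lambda_{\min}$ is the smallest eigenvalue of a symmetric matrix.
   Formalization: The number t of Hessian updates counts only indices 1 ≤ i ≤ k divisible by m, i.e. floor(k/m); the initial Hessian computation at x_0 is not counted, since counting it makes the bound on t false (e.g. k = 1, large m, one-dimensional quadratic). *)

(* Defs.v *)
From mathcomp Require Import all_boot all_order all_algebra.
From mathcomp Require Import all_classical all_reals all_analysis.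

Set Implicit Arguments.
Unset Strict Implicit.
Unset Printing Implicit Defensive.

Import Order.TTheory GRing.Theory Num.Theory.
Import numFieldNormedType.Exports.

Local Open Scope classical_set_scope.
Local Open Scope ring_scope.

Section Euclidean.
Context {R : realType} {d : nat}.
Implicit Types (A B : 'M[R]_d) (u v x y : 'cV[R]_d).

Definition inner u v : R := (u^T *m v) 0 0.

Definition symmetric_mx A : Prop := A^T = A.

Definition symposdef_mx A : Prop :=
  symmetric_mx A /\ forall x, x != 0 -> 0 < inner (A *m x) x.

Definition primal_norm B x : R := Num.sqrt (inner (B *m x) x).

Definition dual_norm B x : R := Num.sqrt (inner x (invmx B *m x)).

Definition operator_norm B A : R :=
  sup [set dual_norm B (A *m x) | x in [set x | primal_norm B x <= 1]].

(* [inf] is a minimum: the spectrum is finite, and it is nonempty when [A] is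
   symmetric and [0 < d]. *)
Definition lambda_min A : R := inf [set a | eigenvalue A a].

(* B^{-1/2}: a symmetric positive definite [B] has exactly one symmetric
   positive definite inverse square root, so the default 0 is not used. *)
Definition invsqrt_mx B : 'M[R]_d :=
  xget 0 [set S | symposdef_mx S /\ S *m S = invmx B].

End Euclidean.

Section Calculus.
Context {R : realType} {d : nat}.
Implicit Types (f : 'cV[R]_d -> R) (x : 'cV[R]_d).

Definition grad f x : 'cV[R]_d := \col_i 'D_(delta_mx i 0) f x.

Definition hess f x : 'M[R]_d :=
  \matrix_(i, j) 'D_(delta_mx j 0) (fun y => grad f y i 0) x.

Definition twice_continuously_differentiable f : Prop :=
  [/\ forall x, differentiable f x,
      forall x, differentiable (grad f) x &
      continuous (hess f)].

Definition xi (B : 'M[R]_d) f x : R :=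
  Num.max (- lambda_min (invsqrt_mx B *m hess f x *m invsqrt_mx B)) 0.

End Calculus.

Section LazyCubicNewton.
Context {R : realType} {d : nat}.
Implicit Types (B : 'M[R]_d) (f : 'cV[R]_d -> R) (x y z : 'cV[R]_d).

Definition cubic_model B f (M : R) x z y : R :=
  inner (grad f x) (y - x) + 2^-1 * inner (hess f z *m (y - x)) (y - x)
  + M / 6 * primal_norm B (y - x) ^+ 3.

(* T is a possible value of T_M(x, z); the minimizer need not be unique. *)
Definition cubic_step B f (M : R) x z (T : 'cV[R]_d) : Prop :=
  forall y, cubic_model B f M x z T <= cubic_model B f M x z y.

Definition last_snapshot (m k : nat) : nat := (k - k %% m)%N.

Definition lazy_cubic_newton B f (m : nat) (M : R) (x : nat -> 'cV[R]_d) :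
    Prop :=
  forall k, cubic_step B f M (x k) (x (last_snapshot m k)) (x k.+1).

End LazyCubicNewton.

(* Index 0 is not counted: the Hessian at the starting point is an initial
   computation, and the Hessian is updated at the indices m, 2m, ... up to k. *)
Definition hessian_updates (m k : nat) : nat :=
  (\sum_(1 <= i < k.+1 | m %| i) 1)%N.

(* Main.v *)
(* Write r_k = ||x_{k+1} - x_k||, s_k = ||x_k - z_k||, a_k = s_k / m, K = m L.
   Comparing the cubic model at x_{k+1} with its value 0 at x_k, and f with its
   Taylor expansion, gives f(x_k) - f(x_{k+1}) >= K (r_k^3 / 2 - a_k^3 / 6).
   As s_k is at most the sum of the r_i since the last snapshot, which are fewer
   than m, the power mean inequality yields sum a_k^3 <= sum r_k^3, so that
   K sum (r_k^3 + a_k^3) <= 6 (f(x_0) - fstar).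
   The minimality of the model on the lines through x_{k+1} gives
   ||grad f(x_k) + H (x_{k+1} - x_k)||_* <= M r_k^2 / 2 and H >= - M r_k B for
   H = hess f(z_k), whence ||grad f(x_{k+1})||_* <= 4 K (r_k + a_k)^2 and
   xi(x_{k+1}) <= 7 K (r_k + a_k); summing suitable powers over k concludes. *)
Require Import Defs.
From mathcomp Require Import all_boot all_order all_algebra ring lra.
From mathcomp Require Import all_classical all_reals all_analysis.
Import Order.TTheory GRing.Theory Num.Theory.
Import numFieldNormedType.Exports.
Local Open Scope ring_scope.

(** * The Euclidean pairing and quadratic forms *)

Section BilinearForms.
Context {R : realType} {d : nat}.
Implicit Types (A B : 'M[R]_d) (u v w x y : 'cV[R]_d) (a : R).

Lemma innerE u v : inner u v = \sum_i u i 0 * v i 0.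
Proof. by rewrite /inner mxE; apply: eq_bigr => i _; rewrite mxE. Qed.

Lemma innerC u v : inner u v = inner v u.
Proof. by rewrite !innerE; apply: eq_bigr => i _; rewrite mulrC. Qed.

Lemma innerDl u v w : inner (u + v) w = inner u w + inner v w.
Proof. by rewrite /inner linearD mulmxDl mxE. Qed.

Lemma innerZl a u v : inner (a *: u) v = a * inner u v.
Proof. by rewrite /inner linearZ -scalemxAl mxE. Qed.

Lemma innerNl u v : inner (- u) v = - inner u v.
Proof. by rewrite -scaleN1r innerZl mulN1r. Qed.

Lemma innerBl u v w : inner (u - v) w = inner u w - inner v w.
Proof. by rewrite innerDl innerNl. Qed.

Lemma innerDr u v w : inner u (v + w) = inner u v + inner u w.
Proof. by rewrite innerC innerDl !(innerC u). Qed.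

Lemma innerZr a u v : inner u (a *: v) = a * inner u v.
Proof. by rewrite innerC innerZl innerC. Qed.

Lemma innerNr u v : inner u (- v) = - inner u v.
Proof. by rewrite innerC innerNl innerC. Qed.

Lemma innerBr u v w : inner u (v - w) = inner u v - inner u w.
Proof. by rewrite innerDr innerNr. Qed.

Lemma inner0l v : inner 0 v = 0.
Proof. by rewrite -(scale0r 0) innerZl mul0r. Qed.

Lemma inner0r v : inner v 0 = 0.
Proof. by rewrite innerC inner0l. Qed.

Lemma inner_mulmx A u v : inner (A *m u) v = inner u (A^T *m v).
Proof. by rewrite /inner trmx_mul mulmxA. Qed.

Lemma inner_delta u i : inner (delta_mx i 0) u = u i 0.
Proof.
rewrite innerE (bigD1 i)//= mxE !eqxx mul1r big1 ?addr0// => j ji.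
by rewrite mxE (negbTE ji) mul0r.
Qed.

Lemma inner_gt0 u : u != 0 -> 0 < inner u u.
Proof.
move=> u0; rewrite lt_def innerE sumr_ge0 ?andbT => [|i _]; last exact: sqr_ge0.
apply: contra u0; rewrite psumr_eq0 => [/allP u0|i _]; last exact: sqr_ge0.
apply/eqP/matrixP => i j; rewrite ord1 mxE.
by have := u0 i (mem_index_enum _); rewrite mulf_eq0 orbb => /eqP.
Qed.

Lemma quadratic_formD A u v a : A^T = A ->
  inner (A *m (u + a *: v)) (u + a *: v) =
  inner (A *m u) u + 2 * a * inner (A *m u) v + a ^+ 2 * inner (A *m v) v.
Proof.
move=> A_sym; have AC : inner (A *m v) u = inner (A *m u) v.
  by rewrite inner_mulmx A_sym innerC.
rewrite mulmxDr -scalemxAr innerDl !innerDr !innerZl !innerZr AC; ring.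
Qed.

(** * Primal, dual and operator norms of a positive definite matrix *)

Section PositiveDefinite.
Context {B : 'M[R]_d} (Bpd : symposdef_mx B).
Local Notation nrm := (primal_norm B).
Local Notation dnrm := (dual_norm B).

Lemma posdef_ge0 v : 0 <= inner (B *m v) v.
Proof.
by have [->|v0] := eqVneq v 0; [rewrite inner0r|apply/ltW; apply: Bpd.2].
Qed.

Lemma innerBC u v : inner (B *m u) v = inner (B *m v) u.
Proof. by rewrite inner_mulmx Bpd.1 innerC. Qed.

Lemma posdef_unit : B \in unitmx.
Proof.
rewrite -row_free_unit -kermx_eq0; apply/eqP/row_matrixP => i; rewrite row0.
have rB : row i (kermx B) *m B = 0 by apply: sub_kermxP; exact: row_sub.
apply/eqP; rewrite -trmx_eq0; apply/negPn/negP => /Bpd.2.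
by rewrite inner_mulmx Bpd.1 /inner trmxK mulmxA rB mul0mx mxE ltxx.
Qed.

Lemma primal_norm_ge0 v : 0 <= nrm v. Proof. exact: sqrtr_ge0. Qed.

Lemma dual_norm_ge0 v : 0 <= dnrm v. Proof. exact: sqrtr_ge0. Qed.

Lemma primal_norm_sqr v : nrm v ^+ 2 = inner (B *m v) v.
Proof. by rewrite sqr_sqrtr// posdef_ge0. Qed.

Lemma primal_norm_eq0 v : nrm v = 0 -> v = 0.
Proof.
move=> v0; apply/eqP/negPn/negP => /Bpd.2.
by rewrite -primal_norm_sqr v0 expr0n ltxx.
Qed.

Lemma primal_normZ a v : nrm (a *: v) = `|a| * nrm v.
Proof.
rewrite /primal_norm -scalemxAr innerZl innerZr mulrA -expr2.
by rewrite sqrtrM ?sqr_ge0// sqrtr_sqr.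
Qed.

Lemma primal_normN v : nrm (- v) = nrm v.
Proof. by rewrite -scaleN1r primal_normZ normrN1 mul1r. Qed.

Lemma primal_norm0 : nrm 0 = 0.
Proof. by rewrite -(scale0r 0) primal_normZ normr0 mul0r. Qed.

Lemma cauchy_schwarz u v : inner (B *m u) v <= nrm u * nrm v.
Proof.
have [/primal_norm_eq0 ->|u0] := eqVneq (nrm u) 0.
  by rewrite primal_norm0 mul0r mulmx0 inner0l.
have [/primal_norm_eq0 ->|v0] := eqVneq (nrm v) 0.
  by rewrite primal_norm0 mulr0 inner0r.
have uv : 0 < nrm u * nrm v by rewrite mulr_gt0 ?lt_def ?u0 ?v0 ?primal_norm_ge0.
(* With p = [nrm u * nrm v], the form at this vector equals 2 p (p - [inner (B *m u) v]), and p is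
   positive. *)
have := posdef_ge0 (nrm v *: u - nrm u *: v).
rewrite mulmxBr -!scalemxAr innerBl !innerBr !innerZl !innerZr (innerBC v u).
by rewrite -!primal_norm_sqr; nra.
Qed.

Lemma primal_normD_sqr u v :
  nrm (u + v) ^+ 2 = nrm u ^+ 2 + 2 * inner (B *m u) v + nrm v ^+ 2.
Proof.
rewrite !primal_norm_sqr mulmxDr innerDl !innerDr (innerBC v u); ring.
Qed.

Lemma primal_normD u v : nrm (u + v) <= nrm u + nrm v.
Proof.
rewrite -ler_sqr ?nnegrE ?addr_ge0 ?primal_norm_ge0// primal_normD_sqr.
have := cauchy_schwarz u v; nra.
Qed.

Lemma primal_normB u v : nrm (u - v) = nrm (v - u).
Proof. by rewrite -primal_normN opprB. Qed.

Lemma primal_norm_sub u v : nrm u <= nrm (u + v) + nrm v.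
Proof. by rewrite -{1}(addrK v u) (le_trans (primal_normD _ _))// primal_normN. Qed.

Lemma parallelogram u v :
  nrm (u + v) ^+ 2 + nrm (u - v) ^+ 2 = 2 * nrm u ^+ 2 + 2 * nrm v ^+ 2.
Proof.
rewrite (primal_normD_sqr u v) (primal_normD_sqr u (- v)) innerNr primal_normN.
by move: (nrm u) (nrm v) (inner _ _) => a b c; ring.
Qed.

Lemma dual_normE w : dnrm w = nrm (invmx B *m w).
Proof.
by rewrite /dual_norm /primal_norm mulmxA mulmxV ?posdef_unit// mul1mx.
Qed.

Lemma inner_le_dual w v : inner w v <= dnrm w * nrm v.
Proof.
rewrite dual_normE; apply: le_trans (cauchy_schwarz _ _).
by rewrite mulmxA mulmxV ?posdef_unit// mul1mx.
Qed.

(** Test at [invmx B *m w]: its primal norm is [dnrm w] and its pairing with [w] is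
    [dnrm w ^+ 2]. *)
Lemma dual_norm_le w c : 0 <= c -> (forall v, inner w v <= c * nrm v) ->
  dnrm w <= c.
Proof.
move=> c0 /(_ (invmx B *m w)); rewrite -dual_normE.
have -> : inner w (invmx B *m w) = dnrm w ^+ 2.
  by rewrite dual_normE primal_norm_sqr mulmxA mulmxV ?posdef_unit ?mul1mx.
have := dual_norm_ge0 w; nra.
Qed.

(** Without an upper bound the [sup] in [operator_norm] would say nothing about [A]. The bound [c]
    comes from estimating each coordinate of a vector by its primal norm times the dual norm of a
    basis vector. *)
Lemma operator_norm_has_ubound A :
  has_ubound [set dnrm (A *m x) | x in [set x | nrm x <= 1]].
Proof.
pose c := \sum_i \sum_j `|A i j| * dnrm (delta_mx j 0) * dnrm (delta_mx i 0).
have coord (x : 'cV_d) i : `|x i 0| <= dnrm (delta_mx i 0) * nrm x.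
  by rewrite ler_norml lerNl -!inner_delta -innerNr -{1}(primal_normN x) !inner_le_dual.
have c0 : 0 <= c.
  by do 2![apply: sumr_ge0 => ? _]; rewrite !mulr_ge0 ?dual_norm_ge0.
exists c => _ [x /= x1 <-]; apply: dual_norm_le => // v.
rewrite innerE /c mulr_suml; apply: ler_sum => i _.
rewrite mxE !mulr_suml; apply: ler_sum => j _.
apply: le_trans (ler_norm _) _; rewrite !normrM -!mulrA ler_wpM2l//.
apply: ler_pM => //.
apply: le_trans (coord x j) _.
by rewrite ler_piMr// dual_norm_ge0.
Qed.

Lemma dual_norm_mulmx A v : dnrm (A *m v) <= operator_norm B A * nrm v.
Proof.
have [/primal_norm_eq0 ->|v0] := eqVneq (nrm v) 0.
  by rewrite primal_norm0 mulr0 mulmx0 dual_normE mulmx0 primal_norm0.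
have vp : 0 < nrm v by rewrite lt_def v0 primal_norm_ge0.
rewrite -ler_pdivrMr//; apply: ub_le_sup; first exact: operator_norm_has_ubound.
exists ((nrm v)^-1 *: v) => /=.
  by rewrite primal_normZ gtr0_norm ?invr_gt0// mulVf.
by rewrite !dual_normE -!scalemxAr primal_normZ gtr0_norm ?invr_gt0// mulrC.
Qed.

Lemma inner_mulmx_le A u v : inner (A *m u) v <= operator_norm B A * nrm u * nrm v.
Proof.
apply: le_trans (inner_le_dual _ _) _.
by rewrite ler_wpM2r ?primal_norm_ge0// dual_norm_mulmx.
Qed.

(* No spectral theorem is needed: were the set of eigenvalues empty, its [inf]
   would be [0], and so would the matrix if [invsqrt_mx] took its default. *)
Lemma lambda_min_ge A c : 0 <= c ->
  (forall v, - c * nrm v ^+ 2 <= inner (A *m v) v) ->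
  - c <= lambda_min (invsqrt_mx B *m A *m invsqrt_mx B).
Proof.
move=> c0 Ac; set S := invsqrt_mx B.
have S_sym : S^T = S.
  by rewrite /S /invsqrt_mx; case: xgetP => [? _ [[]]//|_]; rewrite linear0.
have lb (a : R) : eigenvalue (S *m A *m S) a -> - c <= a.
  move=> /eigenvalueP[v vS v0].
  have vT0 : v^T != 0 by rewrite trmx_eq0.
  have vv := inner_gt0 _ vT0.
  (* [eigenvalue] speaks of row eigenvectors, hence the transposes; the hypothesis on [A] will be
     applied at [S *m v^T]. *)
  have aE : a * inner v^T v^T = inner (A *m (S *m v^T)) (S *m v^T).
    have avE : a *: v^T = S *m (A^T *m (S *m v^T)).
      have -> : a *: v^T = (a *: v)^T by rewrite linearZ.
      by rewrite -vS !trmx_mul S_sym !mulmxA.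
    by rewrite -innerZl avE inner_mulmx S_sym inner_mulmx trmxK innerC.
  (* [S *m B *m S] is the identity, or 0 for the default value of [S]; the inequality covers both
     and suffices because [0 <= c]. *)
  have SBS : nrm (S *m v^T) ^+ 2 <= inner v^T v^T.
    rewrite primal_norm_sqr innerC inner_mulmx S_sym !mulmxA innerC.
    rewrite /S /invsqrt_mx; case: xgetP => [T _ [_ TT]|_]; last first.
      by rewrite !mul0mx inner0l ltW.
    have -> : T *m B *m T = 1%:M.
      by apply: mulmx1C; rewrite mulmxA TT mulVmx// posdef_unit.
    by rewrite mul1mx.
  rewrite -(ler_pM2r vv) aE; apply: le_trans (Ac _).
  by rewrite !mulNr lerN2 ler_wpM2l.
have [[E0 _]|/inf_out] := pselect (has_inf [set a | eigenvalue (S *m A *m S) a]).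
  exact: lb_le_inf.
by rewrite /lambda_min => ->; rewrite oppr_le0.
Qed.

End PositiveDefinite.
End BilinearForms.

(** * One-variable estimates and derivatives along lines *)

Section TaylorExpansion.
Context {R : realType}.

(** Replaces the limit t -> 0 in the symmetry of the Hessian and in the first and second order
    conditions of the cubic step. *)
Lemma le0_of_le_small (a c : R) :
  (forall t : R, 0 < t -> t <= 1 -> a <= c * t) -> a <= 0.
Proof.
move=> H; apply/ler_addgt0Pr => e e0; rewrite add0r.
pose t := Num.min 1 (e / (`|c| + 1)).
have c1 : 0 < `|c| + 1 by rewrite ltr_wpDl.
have t0 : 0 < t by rewrite lt_min ltr01 divr_gt0.
apply: le_trans (H t t0 _) _; first by rewrite ge_min lexx.
have te : t * (`|c| + 1) <= e by rewrite -ler_pdivlMr// ge_min lexx orbT.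
by apply: le_trans te; rewrite mulrC ler_pM2l// (le_trans (ler_norm c))// lerDl.
Qed.

(** Stands in for integrating the derivative bound: after subtracting the cubic polynomial, the mean
    value theorem meets a nonpositive derivative. *)
Lemma increment_le (phi dphi : R -> R) (a b c : R) :
  (forall t : R, is_derive t 1 phi (dphi t)) ->
  (forall t, 0 <= t -> dphi t <= a + 2 * b * t + 3 * c * t ^+ 2) ->
  phi 1 - phi 0 <= a + b + c.
Proof.
move=> phiE dphi_le.
pose psi := phi - (a \*: id + b \*: (@GRing.exp R ^~ 2%N) + c \*: (@GRing.exp R ^~ 3%N)).
have psiE (t : R) : is_derive t 1 psi (dphi t - (a + 2 * b * t + 3 * c * t ^+ 2)).
  apply: is_derive_eq; rewrite /GRing.scale/=; ring.
have [|t t01] := @MVT R psi _ 0 1 ltr01 (fun t _ => psiE t).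
  by apply: derivable_within_continuous => s _; exact: ex_derive.
have := dphi_le t; move: t01; rewrite in_itv/= => /andP[t0 _] /(_ (ltW t0)).
rewrite /psi !fctE /=/GRing.scale/=; lra.
Qed.

Context {d : nat}.
Implicit Types (f : 'cV[R]_d -> R) (u v h x y z : 'cV[R]_d).

Lemma is_derive_line f x h (t : R) : differentiable f (x + t *: h) ->
  is_derive t 1 (fun s => f (x + s *: h)) ('D_h f (x + t *: h)).
Proof.
move=> df.
have E : (fun k : R => k^-1 *: (((fun s => f (x + s *: h)) \o shift t) (k *: 1)
                                 - f (x + t *: h)))
       = (fun k : R => k^-1 *: ((f \o shift (x + t *: h)) (k *: h)
                                 - f (x + t *: h))).
  apply/funext => k /=; rewrite [k *: 1]mulr1 scalerDl.
  by rewrite addrCA.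
split; first by rewrite /derivable E; exact: diff_derivable.
by rewrite /derive E.
Qed.

Lemma derive_grad f x h : differentiable f x -> 'D_h f x = inner (grad f x) h.
Proof.
move=> df; rewrite deriveE// innerE [in LHS](matrix_sum_delta h) linear_sum.
by apply: eq_bigr => i _; rewrite big_ord1 linearZ/= mxE deriveE// mulrC.
Qed.

(** * Taylor bounds under a Lipschitz Hessian, and its symmetry *)

Section LipschitzHessian.
Context {B : 'M[R]_d} (Bpd : symposdef_mx B).
Context {f : 'cV[R]_d -> R} (f2 : twice_continuously_differentiable f).
Context {L : R}.
Context (hessL : forall y z,
  operator_norm B (hess f y - hess f z) <= L * primal_norm B (y - z)).
Local Notation nrm := (primal_norm B).

Lemma is_derive_line_f x h (t : R) :
  is_derive t 1 (fun s => f (x + s *: h)) (inner (grad f (x + t *: h)) h).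
Proof. by case: f2 => df _ _; rewrite -derive_grad//; exact: is_derive_line. Qed.

Lemma is_derive_line_grad x h v (t : R) :
  is_derive t 1 (fun s => inner (grad f (x + s *: h)) v)
    (inner (hess f (x + t *: h) *m h) v).
Proof.
have [_ dg _] := f2.
have dgi i y : differentiable (fun z => grad f z i 0) y.
  by apply: (@differentiable_comp _ _ _ _ (grad f) (fun N => N i 0)) => //;
     exact: differentiable_coord.
have -> : (fun s => inner (grad f (x + s *: h)) v)
        = \sum_i (v i 0 \*: (fun s => grad f (x + s *: h) i 0)).
  apply/funext => s; rewrite innerE fct_sumE; apply: eq_bigr => i _.
  by rewrite mulrC.
have gi i := is_derive_line _ x h t (dgi i (x + t *: h)).
apply: is_derive_eq; rewrite innerE; apply: eq_bigr => i _.
rewrite [LHS]mulrC; congr (_ * _).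
rewrite derive_grad// innerE mxE; apply: eq_bigr => j _; congr (_ * _).
by rewrite !mxE.
Qed.

Lemma hess_lipschitz y z u v :
  inner (hess f y *m u) v <=
  inner (hess f z *m u) v + L * nrm (y - z) * nrm u * nrm v.
Proof.
rewrite -lerBlDl -innerBl -mulmxBl; apply: le_trans (inner_mulmx_le Bpd _ _ _) _.
by rewrite !ler_wpM2r// primal_norm_ge0.
Qed.

Lemma grad_taylor x h v :
  `|inner (grad f (x + h)) v - inner (grad f x) v - inner (hess f x *m h) v|
  <= L / 2 * nrm h ^+ 2 * nrm v.
Proof.
(* A one-sided bound for every direction suffices, as it can be used at both [v] and [- v]. *)
suff main w : inner (grad f (x + h)) w - inner (grad f x) w
    <= inner (hess f x *m h) w + L / 2 * nrm h ^+ 2 * nrm w.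
  rewrite ler_norml; apply/andP; split; last by have := main v; lra.
  have := main (- v); rewrite !innerNr primal_normN; lra.
have := @increment_le _ _ (inner (hess f x *m h) w)
  (L / 2 * nrm h ^+ 2 * nrm w) 0 (is_derive_line_grad x h w).
rewrite scale1r scale0r !addr0; apply => t t0.
apply: le_trans (hess_lipschitz _ x _ _) _.
rewrite (addrC x) addrK primal_normZ (ger0_norm t0); lra.
Qed.

Lemma f_taylor x h :
  `|f (x + h) - f x - inner (grad f x) h - 2^-1 * inner (hess f x *m h) h|
  <= L / 6 * nrm h ^+ 3.
Proof.
set g1 := inner (grad f x) h; set g2 := inner _ h.
have dE t : 0 <= t -> `|inner (grad f (x + t *: h)) h - g1 - t * g2|
    <= L / 2 * t ^+ 2 * nrm h ^+ 3.
  move=> t0; have := grad_taylor x (t *: h) h.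
  rewrite -scalemxAr innerZl primal_normZ (ger0_norm t0) => /le_trans; apply.
  by rewrite le_eqVlt; apply/orP; left; apply/eqP; ring.
rewrite ler_norml; apply/andP; split; last first.
  have := @increment_le _ _ g1 (2^-1 * g2) (L / 6 * nrm h ^+ 3)
    (is_derive_line_f x h).
  rewrite scale1r scale0r addr0 => H.
  suff : f (x + h) - f x <= g1 + 2^-1 * g2 + L / 6 * nrm h ^+ 3 by lra.
  apply: H => t t0; have /ler_normlP[_] := dE t t0; lra.
(* The lower bound is the upper bound for the negated function along the line. *)
have := @increment_le _ _ (- g1) (- (2^-1 * g2)) (L / 6 * nrm h ^+ 3)
  (fun t => is_deriveN (is_derive_line_f x h t)).
rewrite /= !fctE/= scale1r scale0r addr0 => H.
suff : - f (x + h) - - f x <= - g1 + - (2^-1 * g2) + L / 6 * nrm h ^+ 3 by lra.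
apply: H => t t0; have /ler_normlP[] := dE t t0; lra.
Qed.

Lemma f_taylorZ x h (t : R) : 0 <= t ->
  `|f (x + t *: h) - f x - t * inner (grad f x) h
    - 2^-1 * (t ^+ 2 * inner (hess f x *m h) h)| <= L / 6 * (t * nrm h) ^+ 3.
Proof.
move=> t0; have := f_taylor x (t *: h).
by rewrite -scalemxAr innerZl !innerZr primal_normZ (ger0_norm t0) mulrA.
Qed.

(** Here [fu] and [fuv] stand for f at x + t u and x + t u + t v, while [gtv] and [Htv] are
    derivative terms at x + t u. Equating the two expansions of [fuv] cancels all terms of order
    below 2 in t and leaves (t^2 / 2) (Hvu - Huv), up to errors of order t^3. *)
Fact mixed_difference (t gu gv gtv Huu Huv Hvu Hvv Htv fuv fu f0 a b e : R) :
  0 < t ->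
  Htv <= Hvv + L * (t * a) * b * b ->
  `|gtv - gv - t * Huv| <= L / 2 * (t * a) ^+ 2 * b ->
  `|fuv - fu - t * gtv - 2^-1 * (t ^+ 2 * Htv)| <= L / 6 * (t * b) ^+ 3 ->
  `|fu - f0 - t * gu - 2^-1 * (t ^+ 2 * Huu)| <= L / 6 * (t * a) ^+ 3 ->
  `|fuv - f0 - t * (gu + gv) - 2^-1 * (t ^+ 2 * (Huu + Huv + Hvu + Hvv))|
    <= L / 6 * (t * e) ^+ 3 ->
  Hvu - Huv <= (L / 3 * e ^+ 3 + L / 3 * a ^+ 3 + L / 3 * b ^+ 3
    + L * a ^+ 2 * b + L * a * b ^+ 2) * t.
Proof.
move=> t0; rewrite -(ler_pM2l (exprn_gt0 2 t0)) => H1.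
rewrite -(ler_pM2l t0) -{1}(gtr0_norm t0) -normrM => /ler_normlP[_ H2].
move=> /ler_normlP[_ H3] /ler_normlP[_ H4] /ler_normlP[H5 _].
rewrite -(ler_pM2l (exprn_gt0 2 t0)); lra.
Qed.

(* Schwarz's theorem: expand f (x + t u + t v) - f x at order 2 in one step
   and in two steps through x + t u; the errors are of order 3 in t. *)
Lemma hess_sym x : (hess f x)^T = hess f x.
Proof.
suff le_sw u v : inner (hess f x *m v) u - inner (hess f x *m u) v <= 0.
  apply/matrixP => i j; rewrite mxE.
  have entry a b : hess f x a b = inner (hess f x *m delta_mx b 0) (delta_mx a 0).
    by rewrite innerC inner_delta -colE [RHS]mxE.
  rewrite !entry; apply/eqP; rewrite eq_le.
  by apply/andP; split; rewrite -subr_le0; exact: le_sw.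
pose c := L / 3 * nrm (u + v) ^+ 3 + L / 3 * nrm u ^+ 3 + L / 3 * nrm v ^+ 3
  + L * nrm u ^+ 2 * nrm v + L * nrm u * nrm v ^+ 2.
apply: (@le0_of_le_small _ c) => t t0 _.
have := f_taylorZ x (u + v) t (ltW t0).
have -> : inner (hess f x *m (u + v)) (u + v) = inner (hess f x *m u) u
    + inner (hess f x *m u) v + inner (hess f x *m v) u + inner (hess f x *m v) v.
  by rewrite mulmxDr innerDl !innerDr addrA.
have -> : x + t *: (u + v) = x + t *: u + t *: v by rewrite scalerDr addrA.
have -> : inner (grad f x) (u + v) = inner (grad f x) u + inner (grad f x) v.
  exact: innerDr.
have := f_taylorZ x u t (ltW t0).
have := f_taylorZ (x + t *: u) v t (ltW t0).
have : `|inner (grad f (x + t *: u)) v - inner (grad f x) v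
    - t * inner (hess f x *m u) v| <= L / 2 * (t * nrm u) ^+ 2 * nrm v.
  have := grad_taylor x (t *: u) v.
  by rewrite -scalemxAr innerZl primal_normZ (gtr0_norm t0).
have : inner (hess f (x + t *: u) *m v) v
    <= inner (hess f x *m v) v + L * (t * nrm u) * nrm v * nrm v.
  have := hess_lipschitz (x + t *: u) x v v.
  by rewrite (addrC x) addrK primal_normZ (gtr0_norm t0).
move=> H1 H2 H3 H4 H5.
exact: (mixed_difference _ _ _ _ _ _ _ _ _ _ _ _ _ _ _ t0 H1 H2 H3 H4 H5).
Qed.

End LipschitzHessian.
End TaylorExpansion.

(** * Optimality conditions and progress of one cubic step *)

(** Write a = r + p and b = r + q with |p|, |q| <= t. The last hypothesis, which will be the
    parallelogram law, turns 3 r^2 (p + q) into 3 r t^2 - (3/2) r (p^2 + q^2), so no first order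
    term in t survives. *)
Lemma cube_second_difference (R : realFieldType) (r t a b : R) : 0 <= r ->
  r <= a + t -> a <= r + t -> r <= b + t -> b <= r + t ->
  a ^+ 2 + b ^+ 2 = 2 * r ^+ 2 + 2 * t ^+ 2 ->
  a ^+ 3 + b ^+ 3 - 2 * r ^+ 3 <= 6 * r * t ^+ 2 + 2 * t ^+ 3.
Proof.
move=> r0 a1 a2 b1 b2 ab.
have cube (e : R) : - t <= e -> e <= t -> e ^+ 3 <= t * e ^+ 2.
  by move=> _ et; rewrite exprSr mulrC ler_wpM2r ?sqr_ge0.
have sq (e : R) : - t <= e -> e <= t -> e ^+ 2 <= t ^+ 2 by nra.
have [al be] : - t <= a - r /\ a - r <= t by lra.
have [ga de] : - t <= b - r /\ b - r <= t by lra.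
have := cube _ al be; have := cube _ ga de.
have t0 : 0 <= t by lra.
have qa := sq _ al be; have qb := sq _ ga de.
have := ler_wpM2l r0 qa; have := ler_wpM2l r0 qb.
have := ler_wpM2l t0 qa; have := ler_wpM2l t0 qb.
have := congr1 ( *%R r) ab.
lra.
Qed.

Section CubicStep.
Context {R : realType} {d : nat}.
Context {B : 'M[R]_d} (Bpd : symposdef_mx B).
Context {f : 'cV[R]_d -> R} (f2 : twice_continuously_differentiable f).
Context {L : R} (L0 : 0 < L).
Context (hessL : forall y z,
  operator_norm B (hess f y - hess f z) <= L * primal_norm B (y - z)).
Context {M : R} (M0 : 0 < M).
Context {x z T : 'cV[R]_d} (T_step : cubic_step B f M x z T).
Local Notation nrm := (primal_norm B).
Local Notation dnrm := (dual_norm B).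
Local Notation H := (hess f z).
Local Notation h := (T - x).
Local Notation r := (nrm (T - x)).
Local Notation s := (nrm (x - z)).
Local Notation w := (grad f x + H *m h).

Lemma cubic_step_descent :
  f T <= f x - M / 6 * r ^+ 3 + L / 2 * s * r ^+ 2 + L / 6 * r ^+ 3.
Proof.
have := T_step x; rewrite /cubic_model subrr mulmx0 !inner0r primal_norm0.
have /ler_normlP[_] := f_taylor Bpd f2 hessL x h; rewrite (addrC x) subrK.
have := hess_lipschitz Bpd hessL x z h h.
generalize (nrm (x - z)) r (inner (grad f x) h) (inner (H *m h) h).
generalize (inner (hess f x *m h) h) (f T) (f x) => *; lra.
Qed.

(** Minimality on the line through [T] with direction [v]. Symmetry of the Hessian merges the two
    cross terms, so the linear part is the pairing with [w]. *)
Lemma cubic_model_shift v (t : R) :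
  0 <= t * inner w v + t ^+ 2 / 2 * inner (H *m v) v
       + M / 6 * (nrm (h + t *: v) ^+ 3 - r ^+ 3).
Proof.
have := T_step (T + t *: v); rewrite /cubic_model.
have -> : T + t *: v - x = h + t *: v by rewrite addrAC.
have -> : inner (grad f x) (h + t *: v)
        = inner (grad f x) h + t * inner (grad f x) v.
  by rewrite innerDr innerZr.
have -> : inner (H *m (h + t *: v)) (h + t *: v) =
    inner (H *m h) h + 2 * t * inner (H *m h) v + t ^+ 2 * inner (H *m v) v.
  exact: (quadratic_formD _ h v t (hess_sym Bpd f2 hessL z)).
rewrite innerDl.
generalize (inner (H *m h) h) (inner (H *m h) v) (inner (H *m v) v).
generalize (inner (grad f x) h) (inner (grad f x) v) (nrm (h + t *: v)) r => *; lra.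
Qed.

Lemma cubic_model_shiftN v (t : R) :
  0 <= - t * inner w v + t ^+ 2 / 2 * inner (H *m v) v
       + M / 6 * (nrm (h - t *: v) ^+ 3 - r ^+ 3).
Proof. by have := cubic_model_shift v (- t); rewrite scaleNr sqrrN. Qed.

(** First order condition without differentiating the norm: by the triangle inequality a shift by -
    t v raises the cubed norm by at most 3 t r^2 n plus terms of order t^2; divide by t. *)
Lemma cubic_step_stationary : dnrm w <= M / 2 * r ^+ 2.
Proof.
apply: (dual_norm_le Bpd) => [|v]; first by rewrite mulr_ge0 ?sqr_ge0 ?divr_ge0 ?ltW.
rewrite -subr_le0; set n := nrm v.
apply: (@le0_of_le_small _ _
  (inner (H *m v) v / 2 + M / 6 * (3 * r * n ^+ 2 + n ^+ 3))) => t t0 t1.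
have r0 : 0 <= r := primal_norm_ge0 _.
have n0 : 0 <= n := primal_norm_ge0 _.
have nD : nrm (h - t *: v) <= r + t * n.
  by apply: le_trans (primal_normD Bpd _ _) _; rewrite primal_normN primal_normZ gtr0_norm.
have := cubic_model_shiftN v t.
have : nrm (h - t *: v) ^+ 3 <= (r + t * n) ^+ 3.
  by rewrite lerXn2r// ?nnegrE ?primal_norm_ge0// addr_ge0// mulr_ge0// ltW.
move: r0 n0 {nD}; rewrite {}/n.
generalize (nrm v) r (nrm (h - t *: v)) (inner w v) (inner (H *m v) v).
move=> n r k c e r0 n0 kle H0.
rewrite -(ler_pM2l t0).
have : M * t ^+ 3 * n ^+ 3 <= M * t ^+ 2 * n ^+ 3.
  rewrite ler_wpM2r ?exprn_ge0// ler_pM2l// ler_wiXn2l// ltW//.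
have := ler_wpM2l (ltW M0) kle.
lra.
Qed.

(** Adding the shifts by t v and - t v removes the linear term; the second difference of the cubed
    norm is then at most 6 r t^2 n^2 + 2 t^3 n^3. *)
Lemma cubic_step_psd v : - (M * r) * nrm v ^+ 2 <= inner (H *m v) v.
Proof.
rewrite -subr_le0; set n := nrm v.
apply: (@le0_of_le_small _ _ (M / 3 * n ^+ 3)) => t t0 _.
have := cubic_model_shift v t; have := cubic_model_shiftN v t.
have tn : nrm (t *: v) = t * n by rewrite primal_normZ gtr0_norm.
have : nrm (h + t *: v) ^+ 2 + nrm (h - t *: v) ^+ 2
    = 2 * r ^+ 2 + 2 * nrm (t *: v) ^+ 2 by exact: parallelogram.
have := primal_normD Bpd h (t *: v).
have : nrm (h - t *: v) <= r + nrm (t *: v).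
  by rewrite -(primal_normN (t *: v)); exact: primal_normD.
have := primal_norm_sub Bpd h (t *: v).
have : r <= nrm (h - t *: v) + nrm (t *: v).
  by rewrite -(primal_normN (t *: v)); exact: primal_norm_sub.
rewrite tn {tn}/n.
generalize (nrm (h + t *: v)) (nrm (h - t *: v)) (inner w v) (inner (H *m v) v).
have := primal_norm_ge0 v : 0 <= nrm v.
have := primal_norm_ge0 h : 0 <= r.
generalize (nrm v) r => n r r0 n0 a b c e b1 a1 b2 a2 ab Hb Ha.
have := cube_second_difference _ r (t * n) a b r0 a1 a2 b1 b2 ab.
move/(ler_wpM2l (ltW M0)) => cube; rewrite -(ler_pM2l (exprn_gt0 2 t0)); lra.
Qed.

(** Three errors add up: M r^2 / 2 from stationarity, L s r from using the Hessian at [z] in place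
    of [x], and L r^2 / 2 from Taylor. *)
Lemma cubic_step_grad : dnrm (grad f T) <=  (M / 2 + L / 2) * r ^+ 2 + L * s * r.
Proof.
apply: (dual_norm_le Bpd) => [|v].
  by rewrite addr_ge0 ?mulr_ge0 ?sqr_ge0 ?divr_ge0 ?addr_ge0 ?primal_norm_ge0 ?divr_ge0 ?ltW.
have := grad_taylor Bpd f2 hessL x h v; rewrite (addrC x) subrK => /ler_normlP[_].
have := hess_lipschitz Bpd hessL x z h v.
have := inner_le_dual Bpd w v; rewrite innerDl.
have : dnrm w * nrm v <= M / 2 * r ^+ 2 * nrm v.
  by rewrite ler_wpM2r ?primal_norm_ge0// cubic_step_stationary.
generalize (nrm (x - z)) r (inner (H *m h) v) (inner (hess f x *m h) v).
generalize (inner (grad f x) v) (inner (grad f T) v) (dnrm w) (nrm v) => *; lra.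
Qed.

(** The lower bound on the Hessian at [z] is carried over to [T], at distance at most s + r. *)
Lemma cubic_step_xi : xi B f T <= M * r + L * (s + r).
Proof.
have c0 : 0 <= M * r + L * (s + r).
  by rewrite addr_ge0 ?mulr_ge0 ?addr_ge0 ?primal_norm_ge0 ?ltW.
rewrite /xi ge_max c0 andbT lerNl; apply: (lambda_min_ge Bpd) => // v.
have := cubic_step_psd v; have := hess_lipschitz Bpd hessL z T v v.
have : L * nrm (z - T) <= L * (s + r).
  have TzE : T - z = (x - z) + h by rewrite [RHS]addrC addrA subrK.
  by rewrite ler_pM2l// primal_normB TzE primal_normD.
move/(ler_wpM2r (sqr_ge0 (nrm v))).
generalize (nrm (z - T)) r s (inner (H *m v) v) (inner (hess f T *m v) v).
generalize (nrm v) => *; lra.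
Qed.
End CubicStep.

(** * Counting and summing over the windows between snapshots *)

Section SnapshotWindows.
Context {R : realFieldType} {m : nat} (m_gt0 : (0 < m)%N).

Lemma last_snapshot_le k : (last_snapshot m k <= k)%N.
Proof. exact: leq_subr. Qed.

Lemma snapshot_window k : (k < last_snapshot m k + m)%N.
Proof. by rewrite -ltn_subLR ?last_snapshot_le// subKn ?leq_mod// ltn_pmod. Qed.

(** Exchange the sums: an index i belongs only to windows of indices k with i < k < i + m, so each
    [F i] is counted at most m times. *)
Lemma sum_snapshot_windows (F : nat -> R) n : (forall i, 0 <= F i) ->
  \sum_(0 <= k < n) \sum_(last_snapshot m k <= i < k) F i
  <= m%:R * \sum_(0 <= i < n) F i.
Proof.
move=> F0.
have -> : \sum_(0 <= k < n) \sum_(last_snapshot m k <= i < k) F i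
    = \sum_(0 <= k < n) \sum_(0 <= i < n | (last_snapshot m k <= i < k)%N) F i.
  apply: eq_big_nat => k /andP[_ kn].
  rewrite (big_nat_widenl _ 0)// (big_nat_widen _ k n) 1?ltnW//.
rewrite (exchange_big_dep_nat predT)//= mulr_sumr; apply: ler_sum => i _.
rewrite -big_filter big_const_seq count_predT iter_addr_0 -[leLHS]mulr_natl.
rewrite ler_wpM2r// ler_nat -[leqRHS](size_iota i.+1).
apply: uniq_leq_size; first by rewrite filter_uniq// iota_uniq.
move=> k; rewrite mem_filter => /andP[/andP[ki ik] _].
by rewrite mem_iota ik/= addSn ltnS (leq_trans (ltnW (snapshot_window k)))// leq_add2r.
Qed.

(* Power mean inequality on a window: add up the tangent line bound
   u^3 >= 3 a^2 u - 2 a^3 over its at most m indices. *)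
Lemma window_power_mean (r : nat -> R) k a : (forall i, 0 <= r i) -> 0 <= a ->
  m%:R * a <= \sum_(last_snapshot m k <= i < k) r i ->
  m%:R * a ^+ 3 <= \sum_(last_snapshot m k <= i < k) r i ^+ 3.
Proof.
move=> r0 a0 am.
have tangent u : 0 <= u -> 3 * a ^+ 2 * u - 2 * a ^+ 3 <= u ^+ 3.
  move=> u0; rewrite -subr_ge0.
  have -> : u ^+ 3 - (3 * a ^+ 2 * u - 2 * a ^+ 3) = (u - a) ^+ 2 * (u + 2 * a) by ring.
  by rewrite mulr_ge0 ?sqr_ge0// addr_ge0// mulr_ge0.
apply: le_trans (ler_sum _ (fun i _ => tangent _ (r0 i))).
rewrite big_split /= -mulr_sumr sumr_const_nat.
have : 2 * a ^+ 3 *+ (k - last_snapshot m k) <= 2 * a ^+ 3 * m%:R.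
  rewrite -mulr_natr ler_wpM2l ?mulr_ge0 ?exprn_ge0//.
  by rewrite ler_nat leq_subLR ltnW// snapshot_window.
rewrite mulNrn.
have := ler_wpM2l (mulr_ge0 (ler0n R 3) (sqr_ge0 a)) am.
lra.
Qed.

Lemma sum_window_cubes (r a : nat -> R) n :
  (forall i, 0 <= r i) -> (forall i, 0 <= a i) ->
  (forall k, m%:R * a k <= \sum_(last_snapshot m k <= i < k) r i) ->
  \sum_(0 <= k < n) a k ^+ 3 <= \sum_(0 <= k < n) r k ^+ 3.
Proof.
move=> r0 a0 am; have m0 : 0 < m%:R :> R by rewrite ltr0n.
rewrite -(ler_pM2l m0) mulr_sumr; apply: le_trans (sum_snapshot_windows _ _ _).
  by apply: ler_sum => k _; exact: window_power_mean.
by move=> i; rewrite exprn_ge0.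
Qed.

(** Since index 0 is not counted, there is no additive 1, and the bound on k passes to the updates
    with the same constant. *)
Lemma hessian_updatesE k : hessian_updates m k = (k %/ m)%N.
Proof.
rewrite /hessian_updates; elim: k => [|k IHk]; first by rewrite big_geq// div0n.
by rewrite big_mkcond big_nat_recr//= -big_mkcond IHk divnS// addnC; case: ifP.
Qed.

End SnapshotWindows.

(** * Summation along a run of the method *)

Section LazyRun.
Context {R : realType} {d : nat}.
Context {B : 'M[R]_d} (Bpd : symposdef_mx B).
Context {f : 'cV[R]_d -> R} (f2 : twice_continuously_differentiable f).
Context {fstar : R} (f_ge : forall y, fstar <= f y).
Context {L : R} (L0 : 0 < L).
Context (hessL : forall y z,
  operator_norm B (hess f y - hess f z) <= L * primal_norm B (y - z)).
Context {m : nat} (m_gt0 : (0 < m)%N).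
Context {x : nat -> 'cV[R]_d}.
Context (x_run : lazy_cubic_newton B f m (6 * m%:R * L) x).
Local Notation K := (m%:R * L).

Let r k := primal_norm B (x k.+1 - x k).
(** Division by m makes the cubes of [a] and [r] comparable with constant 1, and turns L times the
    snapshot distance into K [a k]. *)
Let a k := primal_norm B (x k - x (last_snapshot m k)) / m%:R.

Let m0 : 0 < m%:R :> R. Proof. by rewrite ltr0n. Qed.
Let m1 : 1 <= m%:R :> R. Proof. by rewrite ler1n. Qed.
Let K0 : 0 < K. Proof. by rewrite mulr_gt0. Qed.
Let LK : L <= K. Proof. by rewrite ler_peMl// ltW. Qed.
Let M0 : 0 < 6 * m%:R * L. Proof. by rewrite -mulrA mulr_gt0. Qed.
Let r0 k : 0 <= r k. Proof. exact: primal_norm_ge0. Qed.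
Let a0 k : 0 <= a k. Proof. by rewrite divr_ge0 ?primal_norm_ge0 ?ltW. Qed.

Let snapshot_dist k : primal_norm B (x k - x (last_snapshot m k)) = m%:R * a k.
Proof. by rewrite mulrC divfK// gt_eqF. Qed.

Let dist_le_steps i j : (i <= j)%N ->
  primal_norm B (x j - x i) <= \sum_(i <= l < j) r l.
Proof.
move=> /subnKC <-; elim: (j - i)%N => [|n IHn].
  by rewrite addn0 subrr primal_norm0 big_geq.
rewrite addnS big_nat_recr ?leq_addr//= addrC.
have -> : x (i + n).+1 - x i = (x (i + n).+1 - x (i + n)%N) + (x (i + n)%N - x i).
  by rewrite addrA subrK.
by apply: le_trans (primal_normD Bpd _ _) _; rewrite lerD2l.
Qed.

Let sum_a_le n : \sum_(0 <= k < n) a k ^+ 3 <= \sum_(0 <= k < n) r k ^+ 3.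
Proof.
apply: (sum_window_cubes m_gt0) => // k.
by rewrite -snapshot_dist dist_le_steps ?last_snapshot_le.
Qed.

(** Since M / 6 = K, the step gains K r^3. Young's inequality bounds the snapshot error K a r^2 / 2
    by K (a^3 / 6 + r^3 / 3), and Taylor costs at most K r^3 / 6; what remains is 1 - 1/3 - 1/6 =
    1/2. *)
Let f_decrease k : K * (r k ^+ 3 / 2 - a k ^+ 3 / 6) <= f (x k) - f (x k.+1).
Proof.
have := cubic_step_descent Bpd f2 hessL (x_run k).
rewrite snapshot_dist -/(r k); move: (r0 k) (a0 k).
move: (r k) (a k) (f (x k)) (f (x k.+1)) => u c fx fT u0 c0 dec.
have young : 3 * c * u ^+ 2 <= c ^+ 3 + 2 * u ^+ 3.
  rewrite -subr_ge0.
  have -> : c ^+ 3 + 2 * u ^+ 3 - 3 * c * u ^+ 2 = (c - u) ^+ 2 * (c + 2 * u) by ring.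
  by rewrite mulr_ge0 ?sqr_ge0// addr_ge0// mulr_ge0.
have := ler_wpM2l (ltW K0) young.
have := ler_wpM2r (exprn_ge0 3 u0) LK.
lra.
Qed.

(** Telescope the decrease. For the sums P of r^3 and Q of a^3, Q <= P gives P / 2 - Q / 6 >= (P +
    Q) / 6. *)
Lemma sum_cubes_le n :
  K * \sum_(0 <= k < n) (r k ^+ 3 + a k ^+ 3) <= 6 * (f (x 0%N) - fstar).
Proof.
have : K * (\sum_(0 <= k < n) r k ^+ 3 / 2 - \sum_(0 <= k < n) a k ^+ 3 / 6)
    <= f (x 0%N) - f (x n).
  rewrite -sumrB mulr_sumr -[leRHS]opprB -(telescope_sumr (f \o x))// -sumrN.
  by apply: ler_sum => k _; rewrite opprB; exact: f_decrease.
have := ler_wpM2l (ltW K0) (sum_a_le n); have := f_ge (x n).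
rewrite -!mulr_suml big_split/=; lra.
Qed.

Let add_cube (u v : R) : 0 <= u -> 0 <= v -> (u + v) ^+ 3 <= 4 * (u ^+ 3 + v ^+ 3).
Proof.
move=> u0 v0; rewrite -subr_ge0.
have -> : 4 * (u ^+ 3 + v ^+ 3) - (u + v) ^+ 3 = 3 * (u + v) * (u - v) ^+ 2 by ring.
by rewrite mulr_ge0 ?sqr_ge0// mulr_ge0// addr_ge0.
Qed.

Let sum_const k (c : R) : \sum_(0 <= i < k) c = k%:R * c.
Proof. by rewrite sumr_const_nat subn0 mulr_natl. Qed.

Lemma iteration_bound eps k : 0 < eps ->
  (forall i, (1 <= i <= k)%N -> eps <= dual_norm B (grad f (x i))) ->
  k%:R * Num.sqrt eps ^+ 3 <= 192 * (Num.sqrt K * (f (x 0%N) - fstar)).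
Proof.
move=> eps0 eps_le; have sK : Num.sqrt K ^+ 2 = K by rewrite sqr_sqrtr ?ltW.
(* Step i controls the gradient at index i + 1, so i < k covers the indices 1 to k. From eps <= 4 K
   (r + a)^2, taking roots and cubing gives 8, and [add_cube] contributes the 4 in 32 = 8 * 4. *)
have step i : (i < k)%N ->
    Num.sqrt eps ^+ 3 <= 32 * Num.sqrt K * (K * (r i ^+ 3 + a i ^+ 3)).
  move=> ik; have := le_trans (eps_le i.+1 ik)
    (cubic_step_grad Bpd f2 L0 hessL M0 (x_run i)).
  rewrite snapshot_dist -/(r i); move: (r0 i) (a0 i) (add_cube _ _ (r0 i) (a0 i)).
  move: (r i) (a i) => u c u0 c0 uc epsE.
  have {}epsE : eps <= (2 * Num.sqrt K * (u + c)) ^+ 2.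
    rewrite !exprMn sK; apply: le_trans epsE _.
    have := ler_wpM2r (sqr_ge0 u) LK.
    have := mulr_ge0 (ltW K0) (sqr_ge0 (u - c)).
    have := mulr_ge0 (ltW K0) (mulr_ge0 u0 c0).
    have := mulr_ge0 (ltW K0) (sqr_ge0 c).
    have := mulr_ge0 (ltW K0) (sqr_ge0 u).
    lra.
  have : Num.sqrt eps <= 2 * Num.sqrt K * (u + c).
    have c2 : 0 <= 2 * Num.sqrt K * (u + c) by rewrite !mulr_ge0 ?sqrtr_ge0 ?addr_ge0.
    by rewrite -(ger0_norm c2) -sqrtr_sqr ler_wsqrtr.
  move=> /(lerXn2r 3); rewrite !nnegrE sqrtr_ge0 !mulr_ge0 ?sqrtr_ge0 ?addr_ge0//.
  move=> /(_ isT isT) /le_trans; apply.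
  have -> : (2 * Num.sqrt K * (u + c)) ^+ 3 = 8 * Num.sqrt K * (K * (u + c) ^+ 3).
    by rewrite -[X in X * (u + c) ^+ 3]sK; ring.
  have := ler_wpM2l (mulr_ge0 (ler0n R 8) (sqrtr_ge0 K)) (ler_wpM2l (ltW K0) uc).
  lra.
have : \sum_(0 <= i < k) Num.sqrt eps ^+ 3
    <= \sum_(0 <= i < k) 32 * Num.sqrt K * (K * (r i ^+ 3 + a i ^+ 3)).
  by apply: ler_sum_nat => i /andP[_]; exact: step.
rewrite sum_const => /le_trans; apply.
rewrite -!mulr_sumr.
have := ler_wpM2l (sqrtr_ge0 K) (sum_cubes_le k); lra.
Qed.

Lemma xi_bound k v : (forall i, (1 <= i <= k)%N -> v <= xi B f (x i)) -> 0 <= v ->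
  k%:R * v ^+ 3 <= 8232 * (K ^+ 2 * (f (x 0%N) - fstar)).
Proof.
move=> v_le v0.
(* Cubing v <= 7 K (r + a) and using [add_cube] gives 1372 = 4 * 7^3; [sum_cubes_le] later
   multiplies by 6. *)
have step i : (i < k)%N -> v ^+ 3 <= 1372 * K ^+ 2 * (K * (r i ^+ 3 + a i ^+ 3)).
  move=> ik; have := le_trans (v_le i.+1 ik)
    (cubic_step_xi Bpd f2 L0 hessL M0 (x_run i)).
  rewrite snapshot_dist -/(r i); move: (r0 i) (a0 i) (add_cube _ _ (r0 i) (a0 i)).
  move: (r i) (a i) => u c u0 c0 uc vE.
  have : v <= 7 * K * (u + c).
    have := ler_wpM2r u0 LK; have := mulr_ge0 (ltW K0) c0; lra.
  move=> /(lerXn2r 3); rewrite !nnegrE v0 !mulr_ge0 ?addr_ge0 ?(ltW L0) ?ler0n//.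
  move=> /(_ isT isT) /le_trans; apply.
  have := ler_wpM2l (exprn_ge0 3 (ltW K0)) uc; rewrite !exprMn; lra.
have : \sum_(0 <= i < k) v ^+ 3
    <= \sum_(0 <= i < k) 1372 * K ^+ 2 * (K * (r i ^+ 3 + a i ^+ 3)).
  by apply: ler_sum_nat => i /andP[_]; exact: step.
rewrite sum_const => /le_trans; apply.
rewrite -!mulr_sumr.
have := ler_wpM2l (sqr_ge0 K) (sum_cubes_le k); lra.
Qed.

End LazyRun.

(** * The three bounds with one absolute constant *)

Theorem theorem3p1 (R : realType) :
  exists C : R, 0 < C /\
  forall (d : nat) (B : 'M[R]_d) (f : 'cV[R]_d -> R) (fstar L : R)
    (m : nat) (M eps : R) (x : nat -> 'cV[R]_d) (k : nat),
  (0 < d)%N ->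
  symposdef_mx B ->
  twice_continuously_differentiable f ->
  (forall y, fstar <= f y) ->
  0 < L ->
  (forall y z, operator_norm B (hess f y - hess f z)
                 <= L * primal_norm B (y - z)) ->
  (1 <= m)%N ->
  M = 6 * m%:R * L ->
  0 < eps ->
  lazy_cubic_newton B f m M x ->
  (forall i, (1 <= i <= k)%N -> eps <= dual_norm B (grad f (x i))) ->
  [/\ k%:R <= C * (Num.sqrt (m%:R * L) * (f (x 0%N) - fstar) / eps `^ (3 / 2)),
      (hessian_updates m k)%:R
        <= C * (Num.sqrt L * (f (x 0%N) - fstar)
                / (eps `^ (3 / 2) * Num.sqrt m%:R)) &
      (1 <= k)%N ->
      \big[Num.min/xi B f (x 1%N)]_(1 <= i < k.+1) xi B f (x i)
        <= C * (M ^+ 2 * (f (x 0%N) - fstar) / k%:R) `^ 3^-1].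
Proof.
(* 192 = 32 * 6 comes from [iteration_bound]; it also serves the eigenvalue bound, where only 8232
   <= 36 * 192^3 is required. *)
exists 192; split=> [|d B f fstar L m M eps x k _ Bpd f2 f_ge L0 hessL m_gt0 -> eps0
  x_run eps_le]; first by rewrite ltr0n.
have epsE : eps `^ (3 / 2) = Num.sqrt eps ^+ 3.
  by rewrite mulrC powRrM powR12_sqrt ?ltW// powR_mulrn ?sqrtr_ge0.
have e0 : 0 < Num.sqrt eps ^+ 3 by rewrite exprn_gt0 ?sqrtr_gt0.
have m0 : 0 < m%:R :> R by rewrite ltr0n.
have D0 : 0 <= f (x 0%N) - fstar by rewrite subr_ge0.
have bound := iteration_bound Bpd f2 f_ge L0 hessL m_gt0 x_run _ _ eps0 eps_le.
rewrite epsE; split.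
- by rewrite mulrA ler_pdivlMr.
- have sm0 : 0 < Num.sqrt m%:R :> R by rewrite sqrtr_gt0.
  rewrite hessian_updatesE// mulrA (ler_pdivlMr _ _ (mulr_gt0 e0 sm0)).
  (* After multiplication by the root of m, the update count appears with factor m, and m times the
     floor of k / m is at most k. *)
  have floor_le : Num.sqrt m%:R ^+ 2 * (k %/ m)%:R <= k%:R :> R.
    by rewrite sqr_sqrtr ?ler0n// -natrM ler_nat mulnC leq_trunc_div.
  rewrite -(ler_pM2l sm0).
  move: bound (ler_wpM2r (ltW e0) floor_le); rewrite sqrtrM ?ler0n//; lra.
- move=> k_gt0; have kR0 : 0 < k%:R :> R by rewrite ltr0n.
  set v := \big[_/_]_(_ <= _ < _) _; set D := f _ - fstar in D0 *.
  have rad0 : 0 <= (6 * m%:R * L) ^+ 2 * D / k%:R :> R.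
    by rewrite divr_ge0// mulr_ge0// sqr_ge0.
  have rhs0 : 0 <= 192 * ((6 * m%:R * L) ^+ 2 * D / k%:R) `^ 3^-1 :> R.
    by rewrite mulr_ge0// powR_ge0.
  (* A negative minimum lies below the nonnegative right-hand side; otherwise cubing both sides
     removes the cube root. *)
  have [v0|/ltW v0] := leP 0 v; last exact: le_trans v0 rhs0.
  have v_le i : (1 <= i <= k)%N -> v <= xi B f (x i).
    by move=> ik; apply: ge_bigmin_seq => //; rewrite mem_index_iota ltnS.
  rewrite -(@ler_pXn2r _ 3) ?nnegrE// exprMn -(powR_mulrn 3 (powR_ge0 _ _)) -powRrM.
  rewrite mulVf ?pnatr_eq0// powRr1//.
  rewrite mulrA ler_pdivlMr// mulrC.
  apply: le_trans (xi_bound Bpd f2 f_ge L0 hessL m_gt0 x_run _ _ v_le v0) _.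
  have : 0 <= (m%:R * L) ^+ 2 * D by rewrite mulr_ge0// sqr_ge0.
  rewrite -/D; lra.
Qed.
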